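(* Let $\{u_i\}_{i=1}^{k}$ and $\{z_i\}_{i=1}^{k}$ ($k\le k_t$) be the vectors generated by the gGKB process applied to $(A,b,B)$, let $k_t$ be its termination step, and let $\mathcal{S}_k=\mathrm{span}\{z_i\}_{i=1}^k$. Then: (i) $\{u_i\}_{i=1}^{k}$ is orthonormal in $\mathbb{R}^m$ (with the Euclidean inner product), and $\{z_i\}_{i=1}^{k}$ is orthonormal in $(\mathcal{R}(C_{rkhs}),\langle\cdot,\cdot\rangle_{C_{rkhs}})$ (in particular $z_i\in\mathcal{R}(C_{rkhs})$). (ii) $\mathcal{S}_k=\mathcal{K}_k(C_{rkhs}^{\dagger}A^\top A,\ C_{rkhs}^{\dagger}A^\top b)$ for each $k\le k_t$, and the termination iteration number is $k_t=\dim\big(\mathcal{K}_\infty(C_{rkhs}^{\dagger}A^\top A,\ C_{rkhs}^{\dagger}A^\top b)\big)$.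
   Context: Let $A\in\mathbb{R}^{m\times n}$, $b\in\mathbb{R}^m$, and let $B\in\mathbb{R}^{n\times n}$ be symmetric positive definite. $\dagger$ denotes the Moore-Penrose pseudo-inverse, and $\mathcal{R}(M)$ the range of a matrix $M$. Let $V\in\mathbb{R}^{n\times n}$ and $\Lambda=\mathrm{diag}(\lambda_1,\dots,\lambda_n)$ satisfy $A^\top AV=BV\Lambda$, $V^\top BV=I_n$. Set $C_{rkhs}=(V\Lambda V^\top)^\dagger$, so that $C_{rkhs}^\dagger=V\Lambda V^\top=B^{-1}A^\top AB^{-1}$. Write $\langle x,y\rangle_{C_{rkhs}}=x^\top C_{rkhs}y$ and $\|x\|_{C_{rkhs}}=\langle x,x\rangle_{C_{rkhs}}^{1/2}$ (a semi-norm on $\mathbb{R}^n$). The generalized Golub-Kahan bidiagonalization (gGKB) generates vectors $u_i\in\mathbb{R}^m$, $z_i\in\mathbb{R}^n$ and scalars $\alpha_i,\beta_i\ge 0$ by $$\beta_1u_1=b,\qquad \alpha_1z_1=C_{rkhs}^\dagger A^\top u_1,$$ $$\beta_{i+1}u_{i+1}=Az_i-\alpha_iu_i,\qquad \alpha_{i+1}z_{i+1}=C_{rkhs}^\dagger A^\top u_{i+1}-\beta_{i+1}z_i\qquad(i\ge1),$$ where $\beta_i$ is the Euclidean norm and $\alpha_i$ the $\|\cdot\|_{C_{rkhs}}$-semi-norm of the respective right-hand side, so that $\|u_i\|_2=\|z_i\|_{C_{rkhs}}=1$. The process stops as soon as some $\alpha_i$ or $\beta_i$ is zero. The termination step is $k_t=\max_{k\ge1}\{\alpha_k\beta_k>0\}$,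 i.e. the largest $k\ge 1$ with $\alpha_k\beta_k>0$. Krylov subspaces: for a square matrix $M$ and a vector $v$, $\mathcal{K}_k(M,v)=\mathrm{span}\{M^iv\}_{i=0}^{k-1}$ and $\mathcal{K}_\infty(M,v)=\mathrm{span}\{M^iv\}_{i=0}^\infty$. *)

(* Defs.v *)
From HB Require Import structures.
From mathcomp Require Import all_boot all_order all_algebra.
From mathcomp Require Import boolp.

Set Implicit Arguments.
Unset Strict Implicit.
Unset Printing Implicit Defensive.

Import Order.TTheory GRing.Theory Num.Theory.

Local Open Scope ring_scope.

Definition dotv (R : rcfType) (p : nat) (x y : 'cV[R]_p) : R :=
  (x^T *m y) 0 0.

Definition norm2 (R : rcfType) (p : nat) (x : 'cV[R]_p) : R :=
  Num.sqrt (dotv x x).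

Definition dotC (R : rcfType) (n : nat) (C : 'M[R]_n) (x y : 'cV[R]_n) : R :=
  (x^T *m C *m y) 0 0.

Definition seminormC (R : rcfType) (n : nat) (C : 'M[R]_n) (x : 'cV[R]_n) : R :=
  Num.sqrt (dotC C x x).

Definition sym_posdef (R : rcfType) (n : nat) (B : 'M[R]_n) : Prop :=
  B^T = B /\ forall x : 'cV[R]_n, x != 0 -> 0 < dotC B x x.

Definition in_range (R : rcfType) (p q : nat) (M : 'M[R]_(p, q))
    (x : 'cV[R]_p) : Prop :=
  exists w : 'cV[R]_q, x = M *m w.

Definition is_moore_penrose (R : rcfType) (p q : nat) (M : 'M[R]_(p, q))
    (X : 'M[R]_(q, p)) : Prop :=
  [/\ M *m X *m M = M,
      X *m M *m X = X,
      (M *m X)^T = M *m X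
    & (X *m M)^T = X *m M].

Lemma moore_penrose_uniq (R : rcfType) (p q : nat) (M : 'M[R]_(p, q))
    (X Y : 'M[R]_(q, p)) :
  is_moore_penrose M X -> is_moore_penrose M Y -> X = Y.
Proof.
move=> [x1 x2 x3 x4] [y1 y2 y3 y4].
have eMX : M *m X = M *m Y.
  rewrite -x3 -{1}y1 -(mulmxA (M *m Y)) trmx_mul x3 y3 mulmxA.
  by rewrite x1.
have eXM : X *m M = Y *m M.
  rewrite -x4 -{1}y1 -(mulmxA M) mulmxA trmx_mul x4 y4.
  by rewrite -mulmxA (mulmxA M) x1.
by rewrite -x2 eXM -mulmxA eMX mulmxA y2.
Qed.

Lemma gram_unit (R : rcfType) (p q : nat) (G : 'M[R]_(p, q)) :
  row_free G -> G *m G^T \in unitmx.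
Proof.
move=> Gfree; rewrite -row_free_unit; apply: inj_row_free => v vG0.
apply: (row_free_inj Gfree); rewrite mul0mx.
have /matrixP/(_ 0 0) : (v *m G) *m (v *m G)^T = 0.
  by rewrite trmx_mul mulmxA -(mulmxA v) vG0 mul0mx.
rewrite !mxE => /eqP.
rewrite psumr_eq0; last by move=> j _; rewrite [(_^T) _ _]mxE -expr2 sqr_ge0.
move=> /allP s0; apply/rowP => j; rewrite [RHS]mxE.
have := s0 j (mem_index_enum _).
by rewrite /= [(_^T) _ _]mxE mulf_eq0 orbb => /eqP.
Qed.

Lemma moore_penrose_exists (R : rcfType) (p q : nat) (M : 'M[R]_(p, q)) :
  exists X : 'M[R]_(q, p), is_moore_penrose M X.
Proof.
have [r [F [G [-> fF fG]]]] : exists r (F : 'M[R]_(p, r)) (G : 'M[R]_(r, q)),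
    [/\ M = F *m G, row_free F^T & row_free G].
  exists (\rank M), (col_base M), (row_base M); split.
  - by rewrite mulmx_base.
  - by rewrite /row_free mxrank_tr; exact: col_base_full.
  - exact: row_base_free.
have uG := gram_unit fG; have := gram_unit fF; rewrite trmxK => uF.
pose IG := invmx (G *m G^T); pose IF := invmx (F^T *m F).
have tIG : IG^T = IG by rewrite /IG trmx_inv trmx_mul trmxK.
have tIF : IF^T = IF by rewrite /IF trmx_inv trmx_mul trmxK.
pose X := (G^T *m IG) *m (IF *m F^T).
have GX : G *m X = IF *m F^T by rewrite /X !mulmxA mulmxV // mul1mx.
have XF : X *m F = G^T *m IG.
  by rewrite /X -!mulmxA mulVmx // mulmx1.
have FF : IF *m F^T *m F = 1%:M by rewrite -mulmxA mulVmx.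
have MX : F *m G *m X = F *m (IF *m F^T) by rewrite -mulmxA GX.
have XM : X *m (F *m G) = G^T *m IG *m G by rewrite mulmxA XF.
exists X; split.
- by rewrite MX -mulmxA (mulmxA (IF *m F^T)) FF mul1mx.
- by rewrite -mulmxA MX mulmxA XF.
- by rewrite MX !trmx_mul trmxK tIF mulmxA.
- by rewrite XM !trmx_mul trmxK tIG mulmxA.
Qed.

Definition mpinv (R : rcfType) (p q : nat) (M : 'M[R]_(p, q)) : 'M[R]_(q, p) :=
  sval (cid (moore_penrose_exists M)).

Lemma mpinvP (R : rcfType) (p q : nat) (M : 'M[R]_(p, q)) :
  is_moore_penrose M (mpinv M).
Proof. exact: (svalP (cid (moore_penrose_exists M))). Qed.

Definition is_span (K : fieldType) (vT : vectType K) (f : nat -> vT)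
    (U : {vspace vT}) : Prop :=
  (forall i, f i \in U) /\
  (forall W : {vspace vT}, (forall i, f i \in W) -> (U <= W)%VS).

Lemma is_span_exists (K : fieldType) (vT : vectType K) (f : nat -> vT) :
  exists U, is_span f U.
Proof.
pose S k : {vspace vT} := <<[seq f i | i <- iota 0 k]>>%VS.
pose P d := `[< exists k, \dim (S k) = d >].
have exP : exists d, P d by exists (\dim (S 0%N)); apply/asboolP; exists 0%N.
have ubP d : P d -> (d <= \dim {:vT})%N.
  by move=> /asboolP[k <-]; rewrite dimvS // subvf.
case: (ex_maxnP exP ubP) => d /asboolP[k dk] dmax.
exists (S k); split=> [i | W fW]; last first.
  by apply/span_subvP => _ /mapP[i _ ->].
pose l := maxn k i.+1.
have kl : (S k <= S l)%VS.
  apply: sub_span => _ /mapP[j jk ->]; apply: map_f.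
  by move: jk; rewrite !mem_iota !add0n /= => jk; rewrite (leq_trans jk) // leq_maxl.
have -> : S k = S l.
  apply/eqP; rewrite eqEdim kl dk; apply: dmax; apply/asboolP; by exists l.
by apply: memv_span; apply: map_f; rewrite mem_iota add0n /= leq_maxr.
Qed.

Definition span_family (K : fieldType) (vT : vectType K) (f : nat -> vT) :
    {vspace vT} :=
  sval (cid (is_span_exists f)).

Lemma span_familyP (K : fieldType) (vT : vectType K) (f : nat -> vT) :
  is_span f (span_family f).
Proof. exact: (svalP (cid (is_span_exists f))). Qed.

Definition krylov (R : rcfType) (n : nat) (M : 'M[R]_n) (v : 'cV[R]_n)
    (k : nat) : {vspace 'cV[R]_n} :=
  <<[seq M ^+ i *m v | i <- iota 0 k]>>%VS.

Definition krylov_inf (R : rcfType) (n : nat) (M : 'M[R]_n) (v : 'cV[R]_n) :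
    {vspace 'cV[R]_n} :=
  span_family (fun i => M ^+ i *m v).

Definition C_rkhs (R : rcfType) (n : nat) (V : 'M[R]_n) (lam : 'rV[R]_n) :
    'M[R]_n :=
  mpinv (V *m diag_mx lam *m V^T).

Record gGKB_state (R : rcfType) (m n : nat) := GGKBState {
  st_u : 'cV[R]_m;
  st_z : 'cV[R]_n;
  st_alpha : R;
  st_beta : R }.

(* [ru] and [rz] are the right-hand sides of the u- and z-recurrences, the
   latter as a function of the new u and beta.  Since 0^-1 = 0, a zero
   normalization coefficient yields a zero vector; as [gGKB_stop] shows, every
   coefficient after the first vanishing one is then zero as well, so that the
   positive alpha_i * beta_i are exactly those met before the process stops. *)
Definition gGKB_normalize (R : rcfType) (m n : nat) (C : 'M[R]_n)
    (ru : 'cV[R]_m) (rz : 'cV[R]_m -> R -> 'cV[R]_n) : gGKB_state R m n :=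
  let beta := norm2 ru in
  let u := beta^-1 *: ru in
  let r := rz u beta in
  let alpha := seminormC C r in
  GGKBState u (alpha^-1 *: r) alpha beta.

(* The state of index i holds u_(i+1), z_(i+1), alpha_(i+1), beta_(i+1). *)
Fixpoint gGKB (R : rcfType) (m n : nat) (A : 'M[R]_(m, n)) (b : 'cV[R]_m)
    (C : 'M[R]_n) (i : nat) : gGKB_state R m n :=
  match i with
  | 0%N => gGKB_normalize C b (fun u _ => mpinv C *m A^T *m u)
  | j.+1 =>
    let s := gGKB A b C j in
    gGKB_normalize C (A *m st_z s - st_alpha s *: st_u s)
      (fun u beta => mpinv C *m A^T *m u - beta *: st_z s)
  end.

(* One-based access; the value at index 0 is meaningless. *)
Definition gGKB_u (R : rcfType) (m n : nat) (A : 'M[R]_(m, n)) (b : 'cV[R]_m)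
    (C : 'M[R]_n) (i : nat) : 'cV[R]_m := st_u (gGKB A b C i.-1).
Definition gGKB_z (R : rcfType) (m n : nat) (A : 'M[R]_(m, n)) (b : 'cV[R]_m)
    (C : 'M[R]_n) (i : nat) : 'cV[R]_n := st_z (gGKB A b C i.-1).
Definition gGKB_alpha (R : rcfType) (m n : nat) (A : 'M[R]_(m, n))
    (b : 'cV[R]_m) (C : 'M[R]_n) (i : nat) : R := st_alpha (gGKB A b C i.-1).
Definition gGKB_beta (R : rcfType) (m n : nat) (A : 'M[R]_(m, n))
    (b : 'cV[R]_m) (C : 'M[R]_n) (i : nat) : R := st_beta (gGKB A b C i.-1).

Lemma gGKB_stop (R : rcfType) (m n : nat) (A : 'M[R]_(m, n)) (b : 'cV[R]_m)
    (C : 'M[R]_n) (i : nat) :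
  (0 < i)%N -> gGKB_alpha A b C i * gGKB_beta A b C i = 0 ->
  gGKB_alpha A b C i.+1 = 0 /\ gGKB_beta A b C i.+1 = 0.
Proof.
case: i => // i _; rewrite /gGKB_alpha /gGKB_beta !succnK.
have sn0 p (D : 'M[R]_p) : seminormC D 0 = 0.
  by rewrite /seminormC /dotC mulmx0 mxE sqrtr0.
have n0 p : norm2 (0 : 'cV[R]_p) = 0.
  by rewrite /norm2 /dotv mulmx0 mxE sqrtr0.
set s := gGKB A b C i => /eqP; rewrite mulf_eq0 => ab0.
have a0 : st_alpha s = 0.
  case/orP: ab0 => /eqP //.
  rewrite /s; case: (i) => [|j] /= ->.
    by rewrite invr0 scale0r mulmx0.
  by rewrite invr0 !scale0r mulmx0 subr0.
have z0 : st_z s = 0.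
  by move: a0; rewrite /s; case: (i) => [|j] /= ->; rewrite invr0 scale0r.
by rewrite /= -/s z0 a0 mulmx0 !scale0r subr0 n0 invr0 !scale0r !mulmx0 subr0.
Qed.

(* kt = max {k >= 1 | alpha_k * beta_k > 0}, read as 0 when this set is
   empty, i.e. when the process stops during its first step. *)
Definition is_termination_step (R : rcfType) (alpha beta : nat -> R)
    (kt : nat) : Prop :=
  ((0 < kt)%N -> 0 < alpha kt * beta kt) /\
  (forall k, (0 < k)%N -> 0 < alpha k * beta k -> (k <= kt)%N).

Definition orthonormal_upto (R : rcfType) (T : Type) (ip : T -> T -> R)
    (x : nat -> T) (k : nat) : Prop :=
  forall i j, (0 < i <= k)%N -> (0 < j <= k)%N -> ip (x i) (x j) = (i == j)%:R.

(* Main.v *)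
Require Import Defs.
From HB Require Import structures.
From mathcomp Require Import all_boot all_order all_algebra.

Set Implicit Arguments.
Unset Strict Implicit.
Unset Printing Implicit Defensive.

Import Order.TTheory GRing.Theory Num.Theory.

Local Open Scope ring_scope.

(** The matrix [P = V *m diag_mx lam *m V^T], whose pseudo-inverse is [C], is a
    Gram matrix [W^T *m W] with [W = A *m V *m V^T].  All that matters is that
    [P] is symmetric and positive semi-definite: then [C] restricts to an inner
    product on the range of [P], and for [z] in that range
    [dotC C z (P *m A^T *m y) = dotv (A *m z) y] ([dotC_PAT]).  So [P *m A^T] is
    the adjoint of [A] between the range of [P] and the Euclidean space, and the
    process is the classical Golub-Kahan bidiagonalization of an operator.

    Every [z_i] lies in the range of [P], by induction; hence a vanishing
    seminorm means a vanishing vector, and the recurrences hold literally,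
    vanishing coefficients included, with the convention that a vector whose
    normalization coefficient is zero is itself zero.  The rest of the proof
    uses only these recurrences ([bidiagonalization]).  Thanks to the
    convention, most facts need no assumption on the number of steps:
    - the [u_i] and the [z_i] are orthogonal families, by the usual joint
      induction ([bidiag_orthogonal]); they consist of unit vectors as long as
      the coefficients are nonzero;
    - eliminating [u] leaves a symmetric three-term recurrence for [z] under
      [M = P *m A^T *m A], with coupling coefficients [al i * be i], and such a
      recurrence forces the span of the first [k] of the [z_i] to be the Krylov
      space of order [k], for every [k] ([three_term_span_krylov]).

    An orthonormal family in the space of [n]-vectors is finite, so some
    coefficient vanishes; counting from zero, let [kt] be the first index with
    [al kt = 0].  From there on every [z_i] is zero, so the spans, hence the
    Krylov spaces, are stationary: the infinite Krylov space is spanned by the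
    [kt] orthonormal vectors met before, and its dimension is [kt]. *)

(** * Symmetric bilinear forms and normalization *)

Section BilinearForm.
Variables (R : rcfType) (p : nat) (G : 'M[R]_p).
Implicit Types x y r : 'cV[R]_p.

Lemma dotvE x y : dotv x y = dotC 1%:M x y.
Proof. by rewrite /dotC mulmx1. Qed.

Lemma dotC0r x : dotC G x 0 = 0.
Proof. by rewrite /dotC mulmx0 mxE. Qed.

Lemma dotCDr x y1 y2 : dotC G x (y1 + y2) = dotC G x y1 + dotC G x y2.
Proof. by rewrite /dotC mulmxDr mxE. Qed.

Lemma dotCZr a x y : dotC G x (a *: y) = a * dotC G x y.
Proof. by rewrite /dotC -scalemxAr mxE. Qed.

Lemma dotC_sumr k (c : 'I_k -> R) (f : 'I_k -> 'cV[R]_p) x :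
  dotC G x (\sum_i c i *: f i) = \sum_i c i * dotC G x (f i).
Proof.
rewrite /dotC mulmx_sumr summxE; apply: eq_bigr => i _.
by rewrite -scalemxAr mxE.
Qed.

Lemma dotC_sym x y : G^T = G -> dotC G x y = dotC G y x.
Proof.
move=> sG; have -> : dotC G x y = (x^T *m G *m y)^T 0 0 by rewrite [RHS]mxE.
by rewrite !trmx_mul trmxK sG mulmxA.
Qed.

(** Where the form is negative at [r] the square root is zero, so that a nonzero
    seminorm already forces [0 < dotC G r r]. *)
Lemma dotC_normalized r :
  seminormC G r != 0 ->
  dotC G ((seminormC G r)^-1 *: r) ((seminormC G r)^-1 *: r) = 1.
Proof.
rewrite /seminormC => s0; rewrite dotCZr {2}/dotC linearZ /= -!scalemxAl mxE.
rewrite -/(dotC G r r) -{3}(@sqr_sqrtr _ (dotC G r r)).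
  by rewrite expr2 mulKf // mulVf.
by case: (ltrP (dotC G r r) 0) => // /ltW /ler0_sqrtr s; rewrite s eqxx in s0.
Qed.

(** Definiteness at [r] covers the degenerate case, in which the normalized
    vector is zero and must rescale to [r = 0]. *)
Lemma scale_normalized r :
  (dotC G r r <= 0 -> r = 0) ->
  seminormC G r *: ((seminormC G r)^-1 *: r) = r.
Proof.
move=> aniso; rewrite scalerA; have [s0|s0] := eqVneq (seminormC G r) 0.
  by rewrite aniso ?scaler0 // -sqrtr_eq0 -/(seminormC G r) s0.
by rewrite divff // scale1r.
Qed.

Lemma orthogonal_free (f : nat -> 'cV[R]_p) k :
  (forall i j, i != j -> dotC G (f i) (f j) = 0) ->
  (forall i, (i < k)%N -> dotC G (f i) (f i) != 0) ->
  free [seq f i | i <- iota 0 k].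
Proof.
move=> ortho nz.
have sz : size [seq f i | i <- iota 0 k] == k by rewrite size_map size_iota.
have /freeP : forall c : 'I_k -> R,
    \sum_(i < k) c i *: (Tuple sz)`_i = 0 -> (forall i, c i = 0); last by [].
move=> c sum0 i.
have : dotC G (f i) (\sum_(j < k) c j *: f j) = 0.
  rewrite -[RHS](dotC0r (f i)) -[in RHS]sum0; congr (dotC G _ _).
  apply: eq_bigr => j _; congr (_ *: _).
  by rewrite -[RHS]/((mkseq f k)`_j) nth_mkseq.
rewrite dotC_sumr (bigD1 i) //= big1 => [|j /negPf ji]; last first.
  by rewrite ortho ?mulr0 // eq_sym; apply/negbT.
by move/eqP; rewrite addr0 mulf_eq0 (negPf (nz _ _)) ?ltn_ord // orbF => /eqP.
Qed.

End BilinearForm.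

Lemma dotv_le0 (R : rcfType) p (x : 'cV[R]_p) : dotv x x <= 0 -> x = 0.
Proof.
have -> : dotv x x = \sum_i x i 0 ^+ 2.
  by rewrite /dotv mxE; apply: eq_bigr => i _; rewrite mxE expr2.
move=> le0; have sq i : true -> 0 <= x i 0 ^+ 2 by rewrite sqr_ge0.
have /eqP : \sum_i x i 0 ^+ 2 = 0 by apply/le_anti; rewrite le0 sumr_ge0.
rewrite psumr_eq0 // => /allP s0; apply/colP => i; rewrite mxE.
by have := s0 i (mem_index_enum _); rewrite sqrf_eq0 => /eqP.
Qed.

(** * The form of the pseudo-inverse on the range *)

Section PseudoInverse.
Variable R : rcfType.

Lemma mpinvK p q (N : 'M[R]_(p, q)) : mpinv (mpinv N) = N.
Proof.
apply: (@moore_penrose_uniq _ _ _ (mpinv N)); first exact: mpinvP.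
by case: (mpinvP N).
Qed.

Lemma mpinv_sym p (N : 'M[R]_p) : N^T = N -> (mpinv N)^T = mpinv N.
Proof.
move=> sN; apply: (@moore_penrose_uniq _ _ _ N); last exact: mpinvP.
move: (mpinv N) (mpinvP N) => X [x1 x2 x3 x4]; split.
- by rewrite -{1 2 3}sN -!trmx_mul mulmxA x1.
- by rewrite -{1}sN -!trmx_mul mulmxA x2.
- by rewrite -{1 2}sN -!trmx_mul x4.
- by rewrite -{1 2}sN -!trmx_mul x3.
Qed.

Variables (p : nat) (N : 'M[R]_p).
Hypothesis symN : N^T = N.

(** [N *m mpinv N] is the identity on the range of [N]; being symmetric, it equals
    [mpinv N *m N], whose values lie in the range of [mpinv N]. *)
Lemma range_mpinv (x : 'cV[R]_p) : in_range N x -> in_range (mpinv N) x.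
Proof.
case=> w ->; exists (N *m N *m w).
case: (mpinvP N) => e _ s _.
by rewrite !mulmxA -{1}e -{1}s trmx_mul mpinv_sym // symN.
Qed.

(** Since [N *m mpinv N *m N = N], the form of [mpinv N] pairs an element of the
    range with [N *m y] as the Euclidean product pairs it with [y]. *)
Lemma dotC_mpinv (x y : 'cV[R]_p) :
  in_range N x -> dotC (mpinv N) x (N *m y) = dotv x y.
Proof.
case=> w ->; case: (mpinvP N) => e _ _ _; rewrite /dotC /dotv trmx_mul symN.
by rewrite -!mulmxA (mulmxA N (mpinv N)) (mulmxA (N *m _)) e.
Qed.

(** If [x = N *m w], its square for [mpinv N] is [w^T *m N *m w], so the form is
    definite on the range as soon as [N] is positive semi-definite.  Positive
    semi-definiteness enters as the property that a vector with nonpositive square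
    lies in the kernel, which is immediate for a Gram matrix. *)
Lemma dotC_mpinv_definite (x : 'cV[R]_p) :
  (forall w : 'cV[R]_p, dotC N w w <= 0 -> N *m w = 0) ->
  in_range N x -> dotC (mpinv N) x x <= 0 -> x = 0.
Proof.
move=> psdN rx; have [w ew] := rx; rewrite {2}ew dotC_mpinv // ew => le0.
by apply: psdN; move: le0; rewrite /dotC /dotv trmx_mul symN.
Qed.

End PseudoInverse.

(** * Three-term recurrences and Krylov spaces *)

Section Spans.
Variables (R : rcfType) (n : nat).
Implicit Types (f g : nat -> 'cV[R]_n) (M : 'M[R]_n) (U : {vspace 'cV[R]_n}).

Let sp f k := <<[seq f i | i <- iota 0 k]>>%VS.

Lemma mem_span_iota f k i : (i < k)%N -> f i \in sp f k.
Proof. by move=> ik; rewrite memv_span // map_f // mem_iota. Qed.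

Lemma span_iota_sub f k U :
  (forall i, (i < k)%N -> f i \in U) -> (sp f k <= U)%VS.
Proof.
by move=> fU; apply/span_subvP => _ /mapP[i + ->]; rewrite mem_iota => /fU.
Qed.

Lemma span_iotaS f k l : (k <= l)%N -> (sp f k <= sp f l)%VS.
Proof.
move=> kl; apply: span_iota_sub => i ik.
by rewrite mem_span_iota // (leq_trans ik).
Qed.

Lemma mulmx_span M f k U x :
  (forall i, (i < k)%N -> M *m f i \in U) -> x \in sp f k -> M *m x \in U.
Proof.
move=> fU xf; have := lfunE (mulmx M : 'cV_n -> 'cV_n) x => <-.
rewrite memv_preim; apply: (subvP (span_iota_sub _)) xf => i ik.
by rewrite -memv_preim lfunE; exact: fU.
Qed.

Lemma krylov_mulmx M v k x : x \in krylov M v k -> M *m x \in krylov M v k.+1.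
Proof.
apply: mulmx_span => i ik; rewrite mulmxA -[M *m _]exprS.
exact: (mem_span_iota (fun i => M ^+ i *m v)).
Qed.

(** The zero value at index 0 lets one formula cover the first step of a
    recurrence and the later ones. *)
Definition predecessor f i := if i is j.+1 then f j else 0.

(** The recurrence shows that [M] raises the index by at most one, whence the
    Krylov space is contained in the span; solved for its leading term it gives
    the converse inclusion.  Solving requires [c i != 0], but when [c i = 0]
    there is nothing to prove, [f i] being zero; this is why the equality holds
    beyond the termination of the process as well. *)
Lemma three_term_span_krylov M v f (c d : nat -> R) :
  v = c 0%N *: f 0%N ->
  (forall i, M *m f i
     = c i.+1 *: f i.+1 + (d i *: f i + c i *: predecessor f i)) ->
  (forall i, c i = 0 -> f i = 0) ->
  forall k, sp f k = krylov M v k.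
Proof.
move=> ev rec c0 k; apply: subv_anti; apply/andP; split; apply: span_iota_sub.
  move=> i ik.
  (* Strengthened to all smaller indices, as the recurrence reaches back two. *)
  suff fK j l : (l <= j)%N -> f l \in krylov M v j.+1.
    apply: (subvP (span_iotaS (fun i => M ^+ i *m v) ik)); exact: fK.
  have solve h U : c h *: f h \in U -> f h \in U.
    have [/c0 ->|cl] := eqVneq (c h) 0; first by rewrite mem0v.
    by move=> /(memvZ (c h)^-1); rewrite scalerA mulVf // scale1r.
  elim: j l => [|j IH] l.
    rewrite leqn0 => /eqP ->; apply: solve; rewrite -ev.
    by have := mem_span_iota (fun i => M ^+ i *m v) (ltn0Sn 0); rewrite mul1mx.
  have KS : {subset krylov M v j.+1 <= krylov M v j.+2}.
    by apply/subvP; apply: span_iotaS.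
  rewrite leq_eqVlt => /predU1P[->|lj]; last by apply/KS/IH.
  apply: solve; rewrite -[c _ *: _](addrK (d j *: f j + c j *: predecessor f j)).
  rewrite -rec.
  rewrite rpredB ?krylov_mulmx ?IH //; apply: KS.
  rewrite rpredD ?memvZ ?IH //; case: (j) IH => [|l'] IH; first exact: mem0v.
  exact/IH.
move=> i; suff Ki : M ^+ i *m v \in sp f i.+1.
  by move=> ik; apply: (subvP (span_iotaS f ik)).
elim: i => [|i IH]; first by rewrite mul1mx ev memvZ // mem_span_iota.
rewrite exprS -[M * _]/(M *m _) -mulmxA; apply: mulmx_span IH => j ji.
rewrite rec !rpredD ?memvZ ?mem_span_iota //; first exact: ltnW.
case: j ji => [|j] ji /=; first exact: mem0v.
by apply: mem_span_iota; apply: leq_trans (ltnW ji) _.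
Qed.

End Spans.

(** * Golub-Kahan bidiagonalizations *)

(** The coupled recurrences with indices counted from zero.  They include the
    degenerate steps: a zero coefficient comes with a zero vector, all later
    vectors then being zero too, so that the sequences are defined for ever. *)
Record bidiagonalization (R : rcfType) m n (A : 'M[R]_(m, n)) (P : 'M[R]_n)
    (b : 'cV[R]_m) (u : nat -> 'cV[R]_m) (z : nat -> 'cV[R]_n)
    (al be : nat -> R) : Prop := {
  bidiag_start : b = be 0%N *: u 0%N;
  bidiag_A : forall i, A *m z i = be i.+1 *: u i.+1 + al i *: u i;
  bidiag_PAT : forall i,
    P *m A^T *m u i = al i *: z i + be i *: predecessor z i;
  bidiag_range : forall i, in_range P (z i);
  bidiag_ge0 : forall i, 0 <= al i /\ 0 <= be i;
  bidiag_u : forall i, if be i == 0 then u i = 0 else dotv (u i) (u i) = 1;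
  bidiag_z : forall i,
    if al i == 0 then z i = 0 else dotC (mpinv P) (z i) (z i) = 1 }.

Section GolubKahan.
Variables (R : rcfType) (m n : nat) (A : 'M[R]_(m, n)) (b : 'cV[R]_m).
Variable P : 'M[R]_n.
Hypothesis symP : P^T = P.
Hypothesis psdP : forall w : 'cV[R]_n, dotC P w w <= 0 -> P *m w = 0.
Let C := mpinv P.
Let u i := st_u (gGKB A b C i).
Let z i := st_z (gGKB A b C i).
Let al i := st_alpha (gGKB A b C i).
Let be i := st_beta (gGKB A b C i).

Let u_rhs i := if i is j.+1 then A *m z j - al j *: u j else b.
Let z_rhs i := P *m A^T *m u i - be i *: predecessor z i.

Lemma gGKBE i : [/\ be i = norm2 (u_rhs i), u i = (be i)^-1 *: u_rhs i,
   al i = seminormC C (z_rhs i) & z i = (al i)^-1 *: z_rhs i].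
Proof.
rewrite /z_rhs /be /al /u /z.
by case: i => [|i]; rewrite /= /C !mpinvK -/C ?scaler0 ?subr0.
Qed.

(** Membership in the range has to come before the recurrences: it is what makes
    a vector of zero seminorm vanish. *)
Lemma range_z_rhs i : in_range P (z_rhs i).
Proof.
have rz j : in_range P (z_rhs j) -> in_range P (z j).
  have [_ _ _ ->] := gGKBE j; case=> w ->; exists ((al j)^-1 *: w).
  by rewrite -scalemxAr.
elim: i => [|i /rz [w ew]].
  by exists (A^T *m u 0%N); rewrite /z_rhs /= scaler0 subr0 mulmxA.
exists (A^T *m u i.+1 - be i.+1 *: w).
by rewrite /z_rhs [predecessor _ _]ew mulmxBr (scalemxAr _ P) mulmxA.
Qed.

Lemma scale_u i : be i *: u i = u_rhs i.
Proof.
have [-> -> _ _] := gGKBE i.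
rewrite /norm2 dotvE -/(seminormC 1%:M (u_rhs i)) scale_normalized //.
by rewrite -dotvE; exact: dotv_le0.
Qed.

Lemma scale_z i : al i *: z i = z_rhs i.
Proof.
have [_ _ -> ->] := gGKBE i; apply: scale_normalized.
exact: dotC_mpinv_definite (range_z_rhs i).
Qed.

(** The generated sequences satisfy the recurrences without any condition on the
    coefficients, by definiteness of both norms on the right-hand sides. *)
Lemma gGKB_bidiagonalization : bidiagonalization A P b u z al be.
Proof.
split=> [|i|i|i|i|i|i].
- by rewrite scale_u.
- by rewrite scale_u /= subrK.
- by rewrite scale_z /z_rhs subrK.
- have [_ _ _ ->] := gGKBE i; have [w ->] := range_z_rhs i.
  by exists ((al i)^-1 *: w); rewrite -scalemxAr.
- by have [-> _ -> _] := gGKBE i; rewrite !sqrtr_ge0.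
- have [eb -> _ _] := gGKBE i; case: eqVneq => [->|].
    by rewrite invr0 scale0r.
  rewrite eb /norm2 !dotvE -/(seminormC 1%:M (u_rhs i)).
  exact: dotC_normalized.
- have [_ _ ea ->] := gGKBE i; case: eqVneq => [->|].
    by rewrite invr0 scale0r.
  by rewrite ea; exact: dotC_normalized.
Qed.

End GolubKahan.

(** * Orthogonality, Krylov spaces and termination *)

Section Bidiagonalization.
Variables (R : rcfType) (m n : nat) (A : 'M[R]_(m, n)) (b : 'cV[R]_m).
Variable P : 'M[R]_n.
Variables (u : nat -> 'cV[R]_m) (z : nat -> 'cV[R]_n) (al be : nat -> R).
Hypothesis symP : P^T = P.
Hypothesis bidiag : bidiagonalization A P b u z al be.
Let C := mpinv P.

Lemma dotv_sym p (x y : 'cV[R]_p) : dotv x y = dotv y x.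
Proof. by rewrite !dotvE dotC_sym // trmx1. Qed.

Lemma u_unit i : be i != 0 -> dotv (u i) (u i) = 1.
Proof. by have := bidiag_u bidiag i; case: eqP. Qed.

Lemma z_unit i : al i != 0 -> dotC C (z i) (z i) = 1.
Proof. by have := bidiag_z bidiag i; case: eqP. Qed.

Lemma be0_u i : be i = 0 -> u i = 0.
Proof. by have := bidiag_u bidiag i; case: eqP. Qed.

Lemma al0_z i : al i = 0 -> z i = 0.
Proof. by have := bidiag_z bidiag i; case: eqP. Qed.

(** With [u i = 0] the recurrence reads [0 = al i *: z i], and [z i] is a unit
    vector unless [al i = 0]. *)
Lemma be0_al i : be i = 0 -> al i = 0.
Proof.
move=> b0; apply/eqP; apply: contraTT isT => an0.
have : al i *: z i = 0.
  by have := bidiag_PAT bidiag i; rewrite be0_u // b0 mulmx0 scale0r addr0.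
move/eqP; rewrite scaler_eq0 (negPf an0) => /eqP z0.
by have := z_unit an0; rewrite z0 dotC0r => /eqP; rewrite eq_sym oner_eq0.
Qed.

Lemma al0_be i : al i = 0 -> be i.+1 = 0.
Proof.
move=> a0; apply/eqP; apply: contraTT isT => bn0.
have : be i.+1 *: u i.+1 = 0.
  by have := bidiag_A bidiag i; rewrite al0_z // a0 mulmx0 scale0r addr0.
move/eqP; rewrite scaler_eq0 (negPf bn0) => /eqP u0.
by have := u_unit bn0; rewrite u0 dotvE dotC0r => /eqP; rewrite eq_sym oner_eq0.
Qed.

Lemma al0_after i j : (i <= j)%N -> al i = 0 -> al j = 0.
Proof. by move/subnK <-; elim: (j - i)%N => // k IH /IH /al0_be /be0_al. Qed.

(** The positivity of the product that defines termination depends on [al i]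
    alone, because [be i = 0] already entails [al i = 0]. *)
Lemma al_be_gt0 i : (0 < al i * be i) = (al i != 0).
Proof.
have [a0 b0] := bidiag_ge0 bidiag i.
rewrite lt_neqAle mulr_ge0 // andbT eq_sym mulf_eq0 negb_or.
by apply: andb_idr; apply: contra_neq; exact: be0_al.
Qed.

(** On the range of [P] the form of [C] makes [P *m A^T] the adjoint of [A]. *)
Lemma dotC_PAT i (y : 'cV[R]_m) :
  dotC C (z i) (P *m A^T *m y) = dotv (A *m z i) y.
Proof.
rewrite -mulmxA dotC_mpinv //; last exact: bidiag_range bidiag i.
by rewrite /dotv trmx_mul mulmxA.
Qed.

(** Joint induction: the adjunction turns the product of [u_(k+1)] with an
    earlier [u_i] into products of earlier [z], and that of [z_(k+1)] with an
    earlier [z_i] into products of [u].  For [i < k] all of these vanish; for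
    [i = k] the two squares that remain cancel because both are 1, or else their
    common coefficient is 0. *)
Lemma bidiag_orthogonal k i j : (i < j <= k)%N ->
  dotv (u j) (u i) = 0 /\ dotC C (z j) (z i) = 0.
Proof.
have symC : C^T = C by exact: mpinv_sym.
elim: k i j => [|k IH] i j.
  by move=> /andP[ij]; rewrite leqn0 => /eqP j0; rewrite j0 in ij.
case/andP=> ij; rewrite leq_eqVlt => /predU1P[ej|jk]; last first.
  by apply: IH; rewrite ij.
have {ij} ik : (i <= k)%N by rewrite ej in ij.
rewrite {j}ej.
have unitE : al k != 0 ->
    dotC C (z k) (z k) = 1 /\ dotv (u k) (u k) = 1.
  move=> ak; split; first exact: z_unit.
  by apply: u_unit; apply: contra_neq ak; exact: be0_al.
have zp h : (h <= k)%N -> dotC C (z k) (predecessor z h) = 0.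
  case: h => [|h] hk; first exact: dotC0r.
  by have [|_ ->] := IH h k; rewrite ?hk ?leqnn.
(* The products with the u h are needed first: they enter those of the z. *)
have ou h : (h <= k)%N -> dotv (u k.+1) (u h) = 0.
  move=> hk; have [/be0_u ->|bn0] := eqVneq (be k.+1) 0.
    by rewrite dotv_sym dotvE dotC0r.
  apply: (mulfI bn0); rewrite mulr0 dotv_sym dotvE -dotCZr.
  rewrite -[be _ *: _](addrK (al k *: u k)) -(bidiag_A bidiag).
  rewrite dotCDr -scaleNr dotCZr -!dotvE.
  have -> : dotv (u h) (A *m z k) = al h * dotC C (z k) (z h).
    rewrite dotv_sym -dotC_PAT (bidiag_PAT bidiag) dotCDr !dotCZr zp //.
    by rewrite mulr0 addr0.
  rewrite leq_eqVlt in hk; case/predU1P: hk => [->|hk].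
    have [->|/unitE[-> ->]] := eqVneq (al k) 0; first by rewrite oppr0 !mul0r addr0.
    by rewrite mulNr subrr.
  have [|e1 ->] := IH h k; rewrite ?hk ?leqnn // mulr0 add0r.
  by rewrite dotv_sym e1 mulr0.
split; first exact: ou.
have [/al0_z ->|an0] := eqVneq (al k.+1) 0.
  by rewrite dotC_sym // dotC0r.
apply: (mulfI an0); rewrite mulr0 dotC_sym // -dotCZr.
rewrite -[al _ *: _](addrK (be k.+1 *: predecessor z k.+1)).
rewrite -(bidiag_PAT bidiag) dotCDr -scaleNr dotCZr dotC_PAT /=.
rewrite dotv_sym (bidiag_A bidiag) dotvE dotCDr !dotCZr -!dotvE (ou i) // mulr0 addr0.
rewrite leq_eqVlt in ik; case/predU1P: ik => [->|ik]; last first.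
  have [|_ e2] := IH i k; rewrite ?ik ?leqnn // ou // dotC_sym // e2.
  by rewrite !mulr0 addr0.
have [->|bn0] := eqVneq (be k.+1) 0; first by rewrite oppr0 !mul0r addr0.
rewrite u_unit // z_unit ?mulr1 ?subrr //.
by apply: contra_neq bn0; exact: al0_be.
Qed.

(** Applying [A] and then [P *m A^T] to [z i] eliminates [u] and produces the
    tridiagonal coefficients, those of the product of a bidiagonal matrix with
    its transpose. *)
Lemma krylov_z k :
  <<[seq z i | i <- iota 0 k]>>%VS = krylov (P *m A^T *m A) (P *m A^T *m b) k.
Proof.
apply: (@three_term_span_krylov _ _ _ _ _ (fun i => al i * be i)
  (fun i => be i.+1 ^+ 2 + al i ^+ 2)).
- rewrite (bidiag_start bidiag) -scalemxAr (bidiag_PAT bidiag) /= scaler0.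
  by rewrite addr0 scalerA mulrC.
- move=> i; rewrite -mulmxA (bidiag_A bidiag) mulmxDr -!scalemxAr.
  rewrite !(bidiag_PAT bidiag) /= !scalerDr !scalerA.
  by rewrite scalerDl -!expr2 !addrA (mulrC (al i.+1)).
- move=> i /eqP; rewrite mulf_eq0 => /orP[]/eqP; first exact: al0_z.
  by move/be0_al/al0_z.
Qed.

Lemma free_z k : (forall i, (i < k)%N -> al i != 0) ->
  free [seq z i | i <- iota 0 k].
Proof.
move=> nz; apply: (@orthogonal_free _ _ C); last first.
  by move=> i /nz /z_unit ->; exact: oner_neq0.
move=> i j; rewrite neq_ltn => /orP[] ij; last first.
  by have [|_ ->] := @bidiag_orthogonal i j i; rewrite ?ij ?leqnn.
rewrite dotC_sym ?mpinv_sym //.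
by have [|_ ->] := @bidiag_orthogonal j i j; rewrite ?ij ?leqnn.
Qed.

(** Otherwise the [z i] would form an infinite free family. *)
Lemma al_vanishes : exists i, al i == 0.
Proof.
pose d := (\dim {:'cV[R]_n}).+1.
have [/existsP[i ai]|] := boolP [exists i : 'I_d, al i == 0]; first by exists i.
rewrite negb_exists => /forallP nz.
have /eqnP : free [seq z i | i <- iota 0 d].
  by apply: free_z => i id_; exact: nz (Ordinal id_).
rewrite size_map size_iota => dimS.
by have := dimvS (subvf <<[seq z i | i <- iota 0 d]>>); rewrite dimS ltnn.
Qed.

(** Past a zero coefficient the [z] are zero, so the increasing union of the
    Krylov spaces is reached at step [k]. *)
Lemma span_krylov_inf k : al k = 0 ->
  <<[seq z i | i <- iota 0 k]>>%VS
    = krylov_inf (P *m A^T *m A) (P *m A^T *m b).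
Proof.
move=> ak; have [inK minK] :=
  span_familyP (fun i => (P *m A^T *m A) ^+ i *m (P *m A^T *m b)).
apply: subv_anti; apply/andP; split.
  by rewrite krylov_z; apply: span_iota_sub => i _; exact: inK.
apply: minK => i.
have : (P *m A^T *m A) ^+ i *m (P *m A^T *m b) \in
    <<[seq z i | i <- iota 0 i.+1]>>%VS.
  by rewrite krylov_z mem_span_iota.
apply: subvP; apply: span_iota_sub => j _.
have [/al0_after/(_ ak)/al0_z ->|jk] := leqP k j; first exact: mem0v.
exact: mem_span_iota.
Qed.

Lemma orthonormal_u k : (forall i, (i < k)%N -> al i != 0) ->
  orthonormal_upto (@dotv R m) (fun i => u i.-1) k.
Proof.
move=> nz [//|i] [//|j] /= ik jk; rewrite eqSS.
have [ij|ij|->] := ltngtP i j.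
- by rewrite dotv_sym; have [|-> _] := @bidiag_orthogonal j i j; rewrite ?ij ?leqnn.
- by have [|-> _] := @bidiag_orthogonal i j i; rewrite ?ij ?leqnn.
- by apply: u_unit; apply: contra_neq (nz j jk); exact: be0_al.
Qed.

Lemma orthonormal_z k : (forall i, (i < k)%N -> al i != 0) ->
  orthonormal_upto (dotC C) (fun i => z i.-1) k.
Proof.
move=> nz [//|i] [//|j] /= ik jk; rewrite eqSS.
have [ij|ij|->] := ltngtP i j; last exact: z_unit (nz j jk).
- rewrite dotC_sym ?mpinv_sym //.
  by have [|_ ->] := @bidiag_orthogonal j i j; rewrite ?ij ?leqnn.
- by have [|_ ->] := @bidiag_orthogonal i j i; rewrite ?ij ?leqnn.
Qed.

(** Here [kt] is the first zero-based index at which [al] vanishes, hence the last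
    one-based index at which it does not.  The basis [z] of the infinite Krylov
    space has exactly that many elements. *)
Lemma bidiagonalization_termination : exists kt : nat,
    [/\ is_termination_step (fun i => al i.-1) (fun i => be i.-1) kt,
        forall k, (k <= kt)%N ->
          [/\ orthonormal_upto (@dotv R m) (fun i => u i.-1) k,
              forall i, (0 < i <= k)%N -> in_range C (z i.-1)
            & orthonormal_upto (dotC C) (fun i => z i.-1) k],
        forall k, (k <= kt)%N ->
          <<[seq z i.-1 | i <- iota 1 k]>>%VS
            = krylov (P *m A^T *m A) (P *m A^T *m b) k
      & kt = \dim (krylov_inf (P *m A^T *m A) (P *m A^T *m b))].
Proof.
case: (ex_minnP al_vanishes) => kt /eqP akt minkt.
have nz i : (i < kt)%N -> al i != 0.
  by move=> ikt; apply/negP => /minkt; rewrite leqNgt ikt.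
exists kt; split.
- split=> [|[//|k] _]; rewrite al_be_gt0; first by case: (kt) nz => // k ->.
  by move=> ak; rewrite ltnNge; apply: contra_neqN ak => /al0_after; apply.
- move=> k kkt; have nzk i : (i < k)%N -> al i != 0.
    by move=> ik; apply: nz; exact: leq_trans kkt.
  split; [exact: orthonormal_u | | exact: orthonormal_z].
  by move=> i _; apply: range_mpinv => //; exact: bidiag_range bidiag _.
- move=> k _; rewrite -krylov_z (iotaDl 1 0) -map_comp; exact: erefl.
- rewrite -(span_krylov_inf akt); have /eqnP -> := free_z nz.
  by rewrite size_map size_iota.
Qed.

End Bidiagonalization.

Theorem theorem4p2 (R : rcfType) (m n : nat) (A : 'M[R]_(m, n))
    (b : 'cV[R]_m) (B V : 'M[R]_n) (lam : 'rV[R]_n)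
    (hB : sym_posdef B)
    (hAV : A^T *m A *m V = B *m V *m diag_mx lam)
    (hVB : V^T *m B *m V = 1%:M) :
  let C := C_rkhs V lam in
  let u := gGKB_u A b C in
  let z := gGKB_z A b C in
  let M := mpinv C *m A^T *m A in
  let v := mpinv C *m A^T *m b in
  exists kt : nat,
    [/\ is_termination_step (gGKB_alpha A b C) (gGKB_beta A b C) kt,
        forall k, (k <= kt)%N ->
          [/\ orthonormal_upto (@dotv R m) u k,
              forall i, (0 < i <= k)%N -> in_range C (z i)
            & orthonormal_upto (dotC C) z k],
        forall k, (k <= kt)%N ->
          <<[seq z i | i <- iota 1 k]>>%VS = krylov M v k
      & kt = \dim (krylov_inf M v)].
Proof.
(* hVB says that V *m V^T is the inverse of B, so that W is A *m B^-1. *)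
pose W := A *m V *m V^T.
have gramP : V *m diag_mx lam *m V^T = W^T *m W.
  rewrite /W !trmx_mul trmxK !mulmxA -2!(mulmxA (V *m V^T)) hAV.
  by rewrite !mulmxA -(mulmxA V V^T) -(mulmxA V (V^T *m B)) hVB mulmx1.
clearbody W.
have symP : (W^T *m W)^T = W^T *m W by rewrite trmx_mul trmxK.
have psdP (w : 'cV[R]_n) : dotC (W^T *m W) w w <= 0 -> W^T *m W *m w = 0.
  have -> : dotC (W^T *m W) w w = dotv (W *m w) (W *m w).
    by rewrite /dotC /dotv trmx_mul !mulmxA.
  by move/dotv_le0 => Ww0; rewrite -mulmxA Ww0 mulmx0.
rewrite /C_rkhs mpinvK gramP.
exact: bidiagonalization_termination symP (gGKB_bidiagonalization A b symP psdP).
Qed.
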